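(* Let $r\ge1$ and $s\ge1$ be integers and let $H$ be an $r$-uniform hypergraph with $s(H)=s$. Then the limit $\lim_{n\to+\infty}\rho\mathrm{sat}(n,H)/n^{s-1}$ exists.
   Context: $K_n^r$ is the complete $r$-uniform hypergraph on $n$ vertices. The sparseness $s(H)$ of a non-empty $r$-uniform $H$ is the size of a smallest $S\subseteq V(H)$ contained in exactly one edge of $H$. A $1$-polymatroid on finite $E$ is $(E,\rho)$ with $\rho:2^E\to\mathbb R$, $0\le\rho(A)\le|A|$, $\rho$ monotone, and $\rho(A\cup B)+\rho(A\cap B)\le\rho(A)+\rho(B)$. It is weakly $H$-saturated (on $E=E(K_n^r)$) if for every copy $\widetilde H\subseteq K_n^r$ of $H$ and $e\in E(\widetilde H)$, $\rho(E(\widetilde H)\setminus\{e\})=\rho(E(\widetilde H))$. $\rho\mathrm{sat}(n,H)$ is the maximum of $\rho(E(K_n^r))$ over all weakly $H$-saturated $1$-polymatroids on $E(K_n^r)$ (this maximum exists). *)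

(* Defs.v *)
From HB Require Import structures.
From mathcomp Require Import all_boot all_order all_algebra.
From mathcomp Require Import all_classical all_reals all_analysis.

Set Implicit Arguments.
Unset Strict Implicit.
Unset Printing Implicit Defensive.

Import Order.TTheory GRing.Theory Num.Theory.
Import numFieldNormedType.Exports.

Local Open Scope ring_scope.

Record uhypergraph (r : nat) := UHypergraph {
  vertex :> finType;
  edges : {set {set vertex}};
  edges_uniform : forall e, e \in edges -> #|e| = r
}.

Section CompleteHypergraph.
Variables n r : nat.

Definition complete_edges : {set {set 'I_n}} := [set e : {set 'I_n} | #|e| == r]%SET.

Lemma complete_edges_uniform e : e \in complete_edges -> #|e| = r.
Proof. by rewrite inE => /eqP. Qed.

Definition complete_uhypergraph : uhypergraph r :=
  UHypergraph complete_edges_uniform.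

End CompleteHypergraph.

Definition in_unique_edge (r : nat) (H : uhypergraph r) (S : {set H}) : bool :=
  #|[set e in edges H | S \subset e]%SET| == 1%N.

(* The default [#|H|] bounds every [#|S|], so this is a genuine minimum as soon
   as [H] has an edge; see [sparsenessP]. *)
Definition sparseness (r : nat) (H : uhypergraph r) : nat :=
  \big[minn/#|H|]_(S : {set H} | in_unique_edge S) #|S|.

Lemma sparsenessP (r : nat) (H : uhypergraph r) : edges H != finset.set0 ->
  (exists2 S : {set H}, in_unique_edge S & #|S| = sparseness H) /\
  (forall S : {set H}, in_unique_edge S -> (sparseness H <= #|S|)%N).
Proof.
case/finset.set0Pn => e eH; have le_sp (S : {set H}) :
    in_unique_edge S -> (sparseness H <= #|S|)%N.
  move=> uS; rewrite /sparseness; elim: index_enum (mem_index_enum S) => //= B s IH.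
  rewrite inE big_cons => /predU1P[<-|/IH le_s]; first by rewrite uS geq_minl.
  by case: ifP => // _; rewrite (leq_trans (geq_minr _ _)).
split=> //.
have ue : in_unique_edge e.
  rewrite /in_unique_edge; apply/eqP; rewrite -[RHS](cards1 e); apply: eq_card => f.
  rewrite !inE; apply/andP/eqP => [[fH ef]|->]; last by rewrite eH subxx.
  by apply/esym/eqP; rewrite eqEcard ef (edges_uniform eH) (edges_uniform fH) /=.
suff [//|spE] : (exists2 S : {set H}, in_unique_edge S & #|S| = sparseness H)
    \/ sparseness H = #|H|.
  exists e => //; apply/eqP; rewrite eqn_leq le_sp // andbT spE; exact: max_card.
rewrite /sparseness.
apply: (big_ind (fun m =>
  (exists2 S : {set H}, in_unique_edge S & #|S| = m) \/ m = #|H|)).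
- by right.
- by move=> x y hx hy; rewrite /minn; case: ifP.
- by move=> S uS; left; exists S.
Qed.

(* [F] is the edge set of a copy of [H] in [G]. *)
Definition copy_edges (r : nat) (H G : uhypergraph r) (F : {set {set G}}) : Prop :=
  exists f : H -> G,
    [/\ injective f, F = [set (f @: (e : {set H}))%SET | e in edges H]%SET & F \subset edges G].
Arguments copy_edges {r} H G F.

(* A 1-polymatroid on a subset [E] of [T]: only the values of [rho] on subsets
   of [E] matter. *)
Definition polymatroid1 (R : realType) (T : finType) (E : {set T})
    (rho : {set T} -> R) : Prop :=
  [/\ forall A : {set T}, A \subset E -> 0 <= rho A <= #|A|%:R,
      forall A B : {set T}, A \subset B -> B \subset E -> rho A <= rho B
    & forall A B : {set T}, A \subset E -> B \subset E ->
        rho (A :|: B)%SET + rho (A :&: B)%SET <= rho A + rho B].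

Definition weakly_saturated (R : realType) (r : nat) (H : uhypergraph r) (n : nat)
    (rho : {set {set 'I_n}} -> R) : Prop :=
  forall F : {set {set 'I_n}}, copy_edges H (complete_uhypergraph n r) F ->
  forall e : {set 'I_n}, e \in F -> rho (F :\ e)%SET = rho F.

Definition saturation_ranks (R : realType) (r : nat) (H : uhypergraph r) (n : nat) :
    set R :=
  [set x | exists rho : {set {set 'I_n}} -> R,
     [/\ polymatroid1 (complete_edges n r) rho, weakly_saturated H rho
       & rho (complete_edges n r) = x]]%classic.

Arguments saturation_ranks R {r} H n.

(* The supremum is attained: see [rhosat_max]. *)
Definition rhosat (R : realType) (r : nat) (H : uhypergraph r) (n : nat) : R :=
  sup (saturation_ranks R H n).
Arguments rhosat R {r} H n.

Section Attained.
Variables (R : realType) (r : nat) (H : uhypergraph r) (n : nat).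
Local Open Scope classical_set_scope.

Let T : finType := {set 'I_n}.
Let E : {set T} := complete_edges n r.
Let PF : topologicalType := prod_topology (fun _ : {set T} => (R : topologicalType)).

Let cv (A : {set T}) (f : PF) : R := f A.

Let ev (A : {set T}) : continuous (cv A).
Proof. exact: (@proj_continuous _ (fun _ : {set T} => (R : topologicalType)) A). Qed.

Let contB (X : topologicalType) (f g : X -> R) :
  continuous f -> continuous g -> continuous (fun x => f x - g x).
Proof. by move=> cf cg x; apply: cvgB; [exact: cf | exact: cg]. Qed.

Let contD (X : topologicalType) (f g : X -> R) :
  continuous f -> continuous g -> continuous (fun x => f x + g x).
Proof. by move=> cf cg x; apply: cvgD; [exact: cf | exact: cg]. Qed.

Let closed_forall (I : Type) (D : I -> Prop) (L : I -> PF -> R) :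
  (forall i, continuous (L i)) -> closed [set f : PF | forall i, D i -> 0 <= L i f].
Proof.
move=> cL.
rewrite (_ : mkset _ = \bigcap_(i in [set i | D i]) (L i @^-1` [set x | 0 <= x])).
  apply: closed_bigI => i _; apply: preimage_closed; last exact: closed_ge.
  by move=> x _; exact: cL.
by apply/seteqP; split.
Qed.

Let feasible : set PF :=
  [set f : PF | forall A : {set T}, `[0, #|A|%:R]%classic (f A : R)] `&`
  [set f : PF | polymatroid1 E f /\ weakly_saturated H f].

Let compact_feasible : compact feasible.
Proof.
apply: compact_closedI.
  apply: (@tychonoff {set T} (fun=> (R : topologicalType)) (fun A : {set T} => `[0, #|A|%:R])).
  by move=> A; exact: segment_compact.
have cB (A B : {set T}) : continuous (fun f : PF => cv A f - cv B f).
  exact (contB (@ev A) (@ev B)).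
set X := (X in closed X).
have -> : X =
    [set f : PF | forall A : {set T}, A \subset E -> 0 <= cv A f] `&`
    [set f : PF | forall A : {set T}, A \subset E -> 0 <= #|A|%:R - cv A f] `&`
    [set f : PF | forall p : {set T} * {set T},
        p.1 \subset p.2 /\ p.2 \subset E -> 0 <= cv p.2 f - cv p.1 f] `&`
    [set f : PF | forall p : {set T} * {set T}, p.1 \subset E /\ p.2 \subset E ->
        0 <= (cv p.1 f + cv p.2 f) - (cv (p.1 :|: p.2)%SET f + cv (p.1 :&: p.2)%SET f)] `&`
    [set f : PF | forall p : {set T} * T,
        copy_edges H (complete_uhypergraph n r) p.1 /\ p.2 \in p.1 ->
        0 <= cv (p.1 :\ p.2)%SET f - cv p.1 f] `&`
    [set f : PF | forall p : {set T} * T,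
        copy_edges H (complete_uhypergraph n r) p.1 /\ p.2 \in p.1 ->
        0 <= cv p.1 f - cv (p.1 :\ p.2)%SET f].
  apply/seteqP; split => f.
    move=> [[f1 f2 f3] f4]; do !split=> /=.
    - by move=> A /f1 /andP[].
    - by move=> A /f1 /andP[_]; rewrite subr_ge0.
    - by move=> [A B] /= [AB BE]; rewrite subr_ge0 f2.
    - by move=> [A B] /= [AE BE]; rewrite subr_ge0 f3.
    - by move=> [F e] /= [cF eF]; rewrite subr_ge0 /cv (f4 F).
    - by move=> [F e] /= [cF eF]; rewrite subr_ge0 /cv (f4 F).
  move=> [[[[[f1 f1'] f2] f3] f4] f4']; split; first split.
  - by move=> A AE; rewrite f1 //= -subr_ge0 f1'.
  - by move=> A B AB BE; rewrite -subr_ge0 (f2 (A, B)).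
  - by move=> A B AE BE; rewrite -subr_ge0 (f3 (A, B)).
  - move=> F cF e eF; apply/eqP; rewrite eq_le -[X in X && _]subr_ge0.
    by rewrite -[X in _ && X]subr_ge0 (f4 (F, e)) // (f4' (F, e)).
repeat apply: closedI; apply: closed_forall => // A.
- exact: (contB (fun=> cvg_cst _) (@ev A)).
- exact: (contB (contD (@ev _) (@ev _)) (contD (@ev _) (@ev _))).
Qed.

Lemma rhosat_max :
  saturation_ranks R H n (rhosat R H n) /\
  (forall x, saturation_ranks R H n x -> x <= rhosat R H n).
Proof.
have feas0 : feasible (fun=> 0).
  split=> [A /=|]; first by rewrite in_itv /= lexx ler0n.
  by split; [split=> *; rewrite ?lexx ?ler0n | move=> *].
have nz : feasible !=set0 by exists (fun=> 0).
have cE : {within feasible, continuous (cv E)}.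
  by apply: continuous_subspaceT => f; exact: ev.
have [rho] := compact_EVT_max nz compact_feasible cE.
rewrite inE => -[_ [prho wrho]] rho_max.
have srho : saturation_ranks R H n (rho E) by exists rho.
have ub x : saturation_ranks R H n x -> x <= rho E.
  move=> [g [[g1 g2 g3] g4 <-]].
  have IE (A : {set T}) : A \subset E -> (A :&: E)%SET = A by move/finset.setIidPl.
  have := rho_max (fun A => g (A :&: E)%SET); rewrite /cv finset.setIid; apply.
  rewrite inE; split=> /= [A|].
    rewrite in_itv /=; have /andP[-> h] := g1 _ (finset.subsetIr A E).
    by apply: le_trans h _; rewrite ler_nat subset_leq_card // finset.subsetIl.
  split; first split.
  - by move=> A AE; rewrite IE // g1.
  - by move=> A B AB BE; rewrite !IE ?g2 // (fintype.subset_trans AB).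
  - move=> A B AE BE; rewrite !IE ?g3 //.
      by rewrite (fintype.subset_trans (finset.subsetIl A B)).
    by rewrite finset.subUset AE.
  - move=> F cF e eF; have [f [_ _ FE]] := cF.
    rewrite !IE ?(g4 F) //.
    by rewrite (fintype.subset_trans (finset.subD1set F e)).
suff -> : rhosat R H n = rho E by [].
apply/eqP; rewrite eq_le /rhosat; apply/andP; split.
  by apply: ge_sup => //; exists (rho E).
by apply: ub_le_sup => //; exists (rho E).
Qed.

End Attained.

(* Main.v *)
Require Import Defs.
From HB Require Import structures.
From mathcomp Require Import all_boot all_order all_algebra.
From mathcomp Require Import zify lra reals.

Import Order.TTheory GRing.Theory Num.Theory.

Local Open Scope ring_scope.

(** Write [k = s - 1] and fix a core [C] of [#|H|] vertices. Some set of [s]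
    vertices lies in a single edge of [H], so an edge with at least [s] vertices
    outside [C] completes a copy of [H] all of whose other edges have fewer
    vertices outside [C]. Hence a weakly [H]-saturated [rho] attains its total rank
    on the edges with at most [k] vertices outside [C]. Distribute that rank as
    weights on these edges, every set of edges weighing at most its rank. The edges
    with fewer than [k] outer vertices weigh [O(n^(k-1))] in total. Those with
    exactly [k] are averaged over all [m]-sets [U] of outer vertices, where each
    [U :|: C] carries at most [rhosat (m + #|H|)]. With [q = #|H| + k] this gives
    [rhosat n / n^k <= O(1/n) + rhosat M / (M - q)^k] for [q < M <= n], so the
    infimum over [M] of the last term is the limit. *)

(** * Binomial estimates and counts of finite sets *)

Lemma bin_mul_bin (N m k : nat) : (k <= m <= N)%N ->
  ('C(N, m) * 'C(m, k) = 'C(N, k) * 'C(N - k, m - k))%N.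
Proof.
case/andP=> km mN; have kN := leq_trans km mN.
have sub_le : (m - k <= N - k)%N by rewrite leq_sub2r.
have /eqP := bin_fact mN; have /eqP := bin_fact kN.
rewrite -(bin_fact km) -(bin_fact sub_le) subnBA // subnK // => /eqP <- /eqP e.
have pos : (0 < k`! * ((m - k)`! * (N - m)`!))%N by rewrite !muln_gt0 !fact_gt0.
by apply/eqP; rewrite -(eqn_pmul2r pos); apply/eqP; lia.
Qed.

Lemma leq_ffact_expn (n k : nat) : (n ^_ k <= n ^ k)%N.
Proof.
elim: k => [|k IH]; first by rewrite ffactn0.
by rewrite ffactnSr expnSr leq_mul // leq_subr.
Qed.

Lemma leq_expn_ffact (n k : nat) : ((n - k) ^ k <= n ^_ k)%N.
Proof.
rewrite ffact_prod -[X in (_ ^ X <= _)%N]card_ord -prod_nat_const.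
by apply: leq_prod => i _; rewrite leq_sub2l // ltnW.
Qed.

(** Removing [X] maps these sets bijectively onto the [(m - #|X|)]-subsets of [W :\: X]. *)
Lemma card_supsets (T : finType) (X W : {set T}) (m : nat) :
  X \subset W -> (#|X| <= m)%N ->
  #|[set U : {set T} | (U \subset W) && (#|U| == m) & X \subset U]| =
    'C(#|W| - #|X|, m - #|X|).
Proof.
move=> XW Xm; have cardD : #|W :\: X| = (#|W| - #|X|)%N.
  by rewrite cardsD (setIidPr XW).
rewrite -cardD -cards_draws.
rewrite -[RHS](card_in_imset (f := fun A => A :|: X)); last first.
  have disj (A : {set T}) : A \in [set A : {set T} | A \subset W :\: X & #|A| == (m - #|X|)%N] ->
      (A :|: X) :\: X = A.
    rewrite inE subsetD => /andP[/andP[_ AX] _].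
    by rewrite setDUl setDv setU0; apply/setDidPl.
  by move=> A B hA hB e; rewrite -[LHS](disj A hA) -[RHS](disj B hB) e.
apply: eq_card => U; rewrite inE; apply/idP/imsetP.
  case/andP=> /andP[UW /eqP cU] XU; exists (U :\: X).
    by rewrite inE setSD //= cardsD (setIidPr XU) cU eqxx.
  by rewrite setUC -{1}(setIidPr XU) setID.
case=> A; rewrite inE subsetD => /andP[/andP[AW AX] /eqP cA] ->.
rewrite subUset AW XW subsetUr andbT /= cardsU.
by rewrite (disjoint_setI0 AX) cards0 subn0 cA subnK.
Qed.

(** Each of the [k] sizes below [k] contributes at most [#|T| ^ (k - 1)] sets. The extra factor
    [#|T|] avoids the exponent [k - 1], which truncates at [k = 0]. *)
Lemma card_small_sets (T : finType) (k : nat) : (0 < #|T|)%N ->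
  (#|[set X : {set T} | #|X| < k]| * #|T| <= k * #|T| ^ k)%N.
Proof.
move=> T0; elim: k => [|k IH].
  rewrite leqn0 muln_eq0 cards_eq0; apply/orP; left; apply/eqP/setP=> X.
  by rewrite !inE.
have -> : [set X : {set T} | (#|X| < k.+1)%N] =
    [set X : {set T} | (#|X| < k)%N] :|: [set X : {set T} | #|X| == k].
  by apply/setP=> X; rewrite !inE ltnS leq_eqVlt orbC.
apply: leq_trans (leq_mul (leq_card_setU _ _) (leqnn _)) _.
rewrite mulnDl mulSn addnC leq_add //.
  rewrite card_draws expnSr leq_mul //.
  apply: leq_trans (leq_ffact_expn _ _).
  by rewrite -bin_ffact leq_pmulr // fact_gt0.
by apply: leq_trans IH _; rewrite leq_mul // leq_pexp2l.
Qed.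

(** A set [X] is determined by [X :&: C], with [2 ^ #|C|] choices, and the small set [X :\: C]. *)
Lemma card_sparse_outside (T : finType) (C : {set T}) (k : nat) : (0 < #|T|)%N ->
  (#|[set X : {set T} | #|X :\: C| < k]| * #|T| <= 2 ^ #|C| * k * #|T| ^ k)%N.
Proof.
move=> T0; rewrite -mulnA.
apply: leq_trans (leq_mul (leqnn (2 ^ #|C|)%N) (card_small_sets T k T0)).
rewrite mulnA leq_mul // -card_powerset -cardsX.
rewrite -(card_imset (f := fun X => (X :&: C, X :\: C))); last first.
  by move=> X Y [e1 e2]; rewrite -(setID X C) -(setID Y C) e1 e2.
apply/subset_leq_card/subsetP => p /imsetP[X]; rewrite inE => Xk ->.
by rewrite inE /= powersetE subsetIr inE.
Qed.

(** * Set induction and construction of injections *)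

Lemma setU1_ind (T : finType) (P : {set T} -> Prop) :
  P set0 -> (forall (x : T) (A : {set T}), x \notin A -> P A -> P (x |: A)) -> forall A, P A.
Proof.
move=> P0 PS A; have [n] := ubnP #|A|; elim: n A => // n IH A.
have [->|[x xA]] := set_0Vmem A; first by [].
rewrite (cardsD1 x) xA ltnS => lt; rewrite -(setD1K xA).
by apply: PS (IH _ lt); rewrite !inE eqxx.
Qed.

Lemma exists_subset_card (T : finType) (A : {set T}) (m : nat) : (m <= #|A|)%N ->
  exists2 B : {set T}, B \subset A & #|B| = m.
Proof.
move=> mA; have : (0 < #|[set B : {set T} | B \subset A & #|B| == m]|)%N.
  by rewrite cards_draws bin_gt0.
by case/card_gt0P=> B; rewrite inE => /andP[BA /eqP Bm]; exists B.
Qed.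

Lemma exists_in_injection (T U : finType) (y : U) (A : {set T}) (B : {set U}) :
  (#|A| <= #|B|)%N ->
  exists2 f : T -> U, {in A &, injective f} & {in A, forall x, f x \in B}.
Proof.
move=> AB; have lt x : x \in A -> (index x (enum A) < size (enum B))%N.
  by move=> xA; rewrite -cardE (leq_trans _ AB) // cardE index_mem mem_enum.
exists (fun x => nth y (enum B) (index x (enum A))) => [x x' xA x'A|x xA].
  move/eqP; rewrite nth_uniq ?lt ?enum_uniq // => /eqP e.
  by rewrite -(nth_index x (s := enum A) (x := x)) ?mem_enum // e nth_index ?mem_enum.
by rewrite -mem_enum mem_nth ?lt.
Qed.

Lemma glue_in_injective (T U : finType) (A D : {set T}) (B : {set U}) (f g : T -> U) :
  {in A &, injective f} -> {in A, forall x, f x \in B} ->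
  {in D :\: A &, injective g} -> {in D :\: A, forall x, g x \notin B} ->
  {in D &, injective (fun x => if x \in A then f x else g x)}.
Proof.
move=> fi fB gi gB x y xD yD.
case: ifPn => xA; case: ifPn => yA e.
- exact: fi.
- by move: (gB y); rewrite -e fB // inE yA yD => /(_ isT).
- by move: (gB x); rewrite e fB // inE xA xD => /(_ isT).
- by apply: gi; rewrite ?inE ?xA ?yA.
Qed.

(** * Rank and closure in a polymatroid *)

Section Polymatroid.
Variables (R : realType) (T : finType) (E : {set T}) (rho : {set T} -> R).
Hypothesis rhoP : polymatroid1 E rho.

(* The weights form a vertex of the base polytope, produced by Edmonds' greedy
   algorithm: each element gets its marginal rank over the earlier ones. *)
Lemma base_weights (G : {set T}) : G \subset E ->
  exists2 w : T -> R, \sum_(x in G) w x = rho G &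
    forall A : {set T}, A \subset G -> \sum_(x in A) w x <= rho A.
Proof.
have [rho_le rho_mono rho_sub] := rhoP.
elim/setU1_ind: G => [|x G xG IH].
  move=> _; exists (fun=> 0) => [|A].
    rewrite big_set0; apply/eqP; rewrite eq_sym.
    by have := rho_le _ (sub0set E); rewrite cards0 eq_le andbC.
  rewrite subset0 => /eqP ->; rewrite big_set0.
  by case/andP: (rho_le _ (sub0set E)).
rewrite subUset sub1set => /andP[xE GE]; have [w wG wle] := IH GE.
pose w' y := if y == x then rho (x |: G) - rho G else w y.
have w'E (A : {set T}) : x \notin A -> \sum_(y in A) w' y = \sum_(y in A) w y.
  move=> xA; apply: eq_bigr => y yA; rewrite /w'; case: eqP => // yx.
  by rewrite -yx yA in xA.
have w'x : w' x = rho (x |: G) - rho G by rewrite /w' eqxx.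
exists w' => [|A AG]; first by rewrite big_setU1 //= w'E // wG w'x subrK.
case: (boolP (x \in A)) => xA; last first.
  rewrite w'E // wle //; apply/subsetP=> y yA.
  by move/subsetP/(_ y yA): AG; rewrite !inE => /predU1P[yx|//]; rewrite -yx yA in xA.
have AxG : A :\ x \subset G by rewrite subDset.
rewrite (big_setD1 x) //= w'E ?w'x; last by rewrite !inE eqxx.
have AE : A \subset E by apply: subset_trans AG _; rewrite subUset sub1set xE.
(* Submodularity bounds the marginal of [x] over [G] by its marginal over [A :\ x]; the weights of
   [A :\ x] are controlled by induction. *)
have := rho_sub A G AE GE.
have -> : A :|: G = x |: G by rewrite -(setD1K xA) -setUA (setUidPr AxG).
have -> : A :&: G = A :\ x.
  apply/setP=> y; rewrite !inE; case: (eqVneq y x) => [->|yx] /=.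
    by rewrite (negPf xG) andbF.
  case: (boolP (y \in A)) => //= yA.
  by move/subsetP/(_ y yA): AG; rewrite !inE (negPf yx).
have := wle _ AxG; lra.
Qed.

(** Elements are added one at a time: [x |: A] and [A :|: B] both contain [A], so submodularity
    keeps the rank of their union at [rho A]. *)
Lemma rank_setU_absorb (A B : {set T}) : A \subset E -> B \subset E ->
  (forall x, x \in B -> rho (x |: A) <= rho A) -> rho (A :|: B) = rho A.
Proof.
have [_ rho_mono rho_sub] := rhoP.
move=> AE; elim/setU1_ind: B => [|x B xB IH]; first by rewrite setU0.
rewrite subUset sub1set => /andP[xE BE] absorb.
have {}IH : rho (A :|: B) = rho A.
  by apply: IH => // y yB; apply: absorb; rewrite !inE yB orbT.
have UE : A :|: (x |: B) \subset E by rewrite !subUset AE BE sub1set xE.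
apply/eqP; rewrite eq_le (rho_mono _ _ _ UE) ?subsetUl // andbT.
have xAE : x |: A \subset E by rewrite subUset sub1set xE.
have ABE : A :|: B \subset E by rewrite subUset AE.
have := rho_sub _ _ xAE ABE.
have -> : (x |: A) :|: (A :|: B) = A :|: (x |: B) by rewrite -setUA (setUA A A) setUid setUCA.
have := rho_mono A ((x |: A) :&: (A :|: B)).
rewrite subsetI subsetUr subsetUl => /(_ isT (subset_trans (subsetIr _ _) ABE)).
by have := absorb x; rewrite !inE eqxx => /(_ isT); lra.
Qed.

(** Marginals decrease as the set grows: [x] adds nothing to [F :\ x], hence nothing to the larger
    [A]. *)
Lemma rank_setU1_closed (A F : {set T}) (x : T) : A \subset E -> F \subset E ->
  x \in F -> rho (F :\ x) = rho F -> F :\ x \subset A -> rho (x |: A) <= rho A.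
Proof.
have [_ rho_mono rho_sub] := rhoP.
move=> AE FE xF eF FA; have := rho_sub A F AE FE.
have -> : A :|: F = x |: A by rewrite -(setD1K xF) setUCA (setUidPl FA).
have := rho_mono (F :\ x) (A :&: F); rewrite subsetI FA subD1set.
by move=> /(_ isT (subset_trans (subsetIl _ _) AE)); lra.
Qed.

End Polymatroid.

(** * Pulling a polymatroid back along a vertex injection *)

Lemma imset_setD1 (T U : finType) (g : T -> U) (F : {set T}) (x : T) :
  injective g -> g @: (F :\ x) = (g @: F) :\ g x.
Proof.
move=> gi; apply/setP=> y; rewrite !inE; apply/imsetP/andP.
  case=> z; rewrite !inE => /andP[zx zF] ->.
  by rewrite (inj_eq gi) zx imset_f.
by case=> yx /imsetP[z zF yz]; exists z; rewrite // !inE zF andbT -(inj_eq gi) -yz.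
Qed.

(** The pullback of [rho] along [g] competes in the maximum [rhosat R H M], because [g] carries
    copies of [H] to copies of [H]. *)
Lemma rank_image_le (R : realType) (r : nat) (H : uhypergraph r) (n M : nat)
    (g : 'I_M -> 'I_n) (rho : {set {set 'I_n}} -> R) :
  injective g -> polymatroid1 (complete_edges n r) rho -> weakly_saturated H rho ->
  rho [set g @: (e : {set 'I_M}) | e in complete_edges M r] <= rhosat R H M.
Proof.
move=> gi [rho_le rho_mono rho_sub] satr.
pose phi (e : {set 'I_M}) := g @: e.
have phi_inj : injective phi by exact: imset_inj.
have phiE (A : {set {set 'I_M}}) :
    A \subset complete_edges M r -> phi @: A \subset complete_edges n r.
  move/subsetP=> AE; apply/subsetP=> _ /imsetP[e /AE eE ->].
  by rewrite inE card_imset //; rewrite inE in eE.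
apply: (rhosat_max R H M).2; exists (fun A : {set {set 'I_M}} => rho (phi @: A)); split=> //.
  split=> [A AE|A B AB BE|A B AE BE].
  - by rewrite -(card_imset (mem A) phi_inj); apply: rho_le; exact: phiE.
  - by rewrite rho_mono ?phiE // imsetS.
  - rewrite imsetU imsetI; last by move=> x y _ _; exact: phi_inj.
    by rewrite rho_sub ?phiE.
move=> F [f [f_inj FE Fsub]] e eF.
rewrite imset_setD1 //; apply: satr; last by rewrite imset_f.
exists (g \o f); split; last exact: phiE.
  exact: inj_comp.
rewrite FE -imset_comp; apply: eq_imset => d /=.
by rewrite /phi -imset_comp.
Qed.

(** * Reduction to the edges near the core *)

Definition near_core (n r : nat) (C : {set 'I_n}) (j : nat) : {set {set 'I_n}} :=
  [set T in complete_edges n r | (#|T :\: C| <= j)%N].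

Lemma near_core_sub (n r : nat) (C : {set 'I_n}) (j : nat) :
  near_core n r C j \subset complete_edges n r.
Proof. by apply/subsetP=> T; rewrite inE => /andP[]. Qed.

(* Place the uniquely covered set [S] outside the core and the vertices of [H]
   off its edge [e0] inside the core: then every other edge of the copy misses a
   vertex of [S], so it has fewer vertices outside the core than [T]. *)
Lemma exists_copy_near_core (r : nat) (H : uhypergraph r) (n : nat)
    (C T : {set 'I_n}) (S : {set H}) (j : nat) :
  (#|H| <= #|C|)%N -> in_unique_edge S -> T \in complete_edges n r ->
  (#|S| <= j.+1)%N -> #|T :\: C| = j.+1 ->
  exists F : {set {set 'I_n}}, [/\ copy_edges H (complete_uhypergraph n r) F,
    T \in F & F :\ T \subset near_core n r C j].
Proof.
move=> HC /cards1P[e0 Se0] TE Sj cardTC.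
have /setP/(_ e0) := Se0; rewrite !inE eqxx => /andP[e0H Se].
have cardT : #|T| = r by apply/eqP; rewrite inE in TE.
have carde0 : #|e0| = r by exact: edges_uniform.
(* [y] inhabits ['I_n] and serves as the default value in [exists_in_injection]. *)
have [y yTC] : exists y, y \in T :\: C by apply/card_gt0P; rewrite cardTC.
have [S' S'TC cardS'] : exists2 S' : {set 'I_n}, S' \subset T :\: C & #|S'| = #|S|.
  by apply: exists_subset_card; rewrite cardTC.
have S'T : S' \subset T by apply: subset_trans S'TC (subsetDl _ _).
have [f1 f1i f1S] : exists2 f : H -> 'I_n, {in S &, injective f} &
    {in S, forall x, f x \in S'}.
  by apply: exists_in_injection; rewrite // cardS'.
have [f2 f2i f2T] : exists2 f : H -> 'I_n, {in e0 :\: S &, injective f} &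
    {in e0 :\: S, forall x, f x \in T :\: S'}.
  apply: exists_in_injection => //.
  by rewrite !cardsD (setIidPr Se) (setIidPr S'T) cardS' cardT carde0.
have [f3 f3i f3C] : exists2 f : H -> 'I_n, {in [set: H] :\: e0 &, injective f} &
    {in [set: H] :\: e0, forall x, f x \in C :\: T}.
  apply: exists_in_injection => //.
  (* There is room in [C :\: T] because [#|H| <= #|C|] and [C :&: T] has at most [r = #|e0|]
     elements. *)
  rewrite !cardsD setTI cardsT carde0.
  by rewrite leq_sub // -cardT subset_leq_card // subsetIr.
pose g x := if x \in S then f1 x else f2 x.
pose f x := if x \in e0 then g x else f3 x.
have gi : {in e0 &, injective g}.
  apply: (glue_in_injective _ _ S e0 S' f1 f2) => // x /f2T.
  by rewrite inE => /andP[].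
have gT : {in e0, forall x, g x \in T}.
  move=> x xe; rewrite /g; case: ifPn => xS; first exact: (subsetP S'T _ (f1S _ xS)).
  by have := f2T x; rewrite !inE xS xe => /(_ isT) /andP[].
have fi : injective f.
  suff fi : {in [set: H] &, injective f} by move=> x z; apply: fi; rewrite inE.
  apply: (glue_in_injective _ _ e0 [set: H] T g f3) => // x /f3C.
  by rewrite inE => /andP[].
have fe0 : f @: e0 = T.
  apply/eqP; rewrite eqEcard card_imset // cardT carde0 leqnn andbT.
  by apply/subsetP=> _ /imsetP[x xe ->]; rewrite /f xe gT.
exists [set f @: (e : {set H}) | e in edges H]; split.
- exists f; split=> //; apply/subsetP=> _ /imsetP[e eH ->].
  by rewrite inE card_imset // (edges_uniform eH).
- by apply/imsetP; exists e0.
apply/subsetP=> X; rewrite !inE => /andP[XT /imsetP[e eH XE]].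
have cardX : #|X| = r by rewrite XE card_imset // (edges_uniform eH).
rewrite cardX eqxx /=.
(* Only [e0] contains [S], and [e] differs from [e0] because its image is not [T]. *)
have [x xS xe] : exists2 x, x \in S & x \notin e.
  apply/subsetPn; apply: contra XT => Ssube.
  by have /setP/(_ e) := Se0; rewrite !inE eH Ssube XE => /esym/eqP ->; rewrite fe0.
have xe0 := subsetP Se _ xS.
have fxTC : f x \in T :\: C.
  by apply: (subsetP S'TC); rewrite /f xe0 /g xS f1S.
(* [X :\: C] lies in [T :\: C], since vertices off [e0] go into [C], and it omits [f x]: this strict
   loss gives at most [j]. *)
rewrite -ltnS -cardTC (cardsD1 (f x) (T :\: C)) fxTC add1n ltnS.
apply/subset_leq_card/subsetP => z; rewrite !inE => /andP[zC zX].
rewrite zC /=; move: zX zC; rewrite XE => /imsetP[u ue ->] fuC.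
rewrite (inj_eq fi); apply/andP; split; first by apply: contraNneq xe => <-.
move: fuC; rewrite /f; case: ifPn => [ue0 _|ue0]; first exact: gT.
by have := f3C u; rewrite !inE ue0 => /(_ isT) /andP[_ ->].
Qed.

(** For [j >= k], an edge with exactly [j.+1] outer vertices completes a copy of [H] whose other
    edges lie in layer [j]. Each layer down to [k] is thus absorbed by the one below. *)
Lemma rank_near_core (R : realType) (r : nat) (H : uhypergraph r) (n k : nat)
    (C : {set 'I_n}) (S : {set H}) (rho : {set {set 'I_n}} -> R) :
  (#|H| <= #|C|)%N -> in_unique_edge S -> (#|S| <= k.+1)%N ->
  polymatroid1 (complete_edges n r) rho -> weakly_saturated H rho ->
  rho (near_core n r C k) = rho (complete_edges n r).
Proof.
move=> HC uS Sk rhoP satr.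
have step j : (k <= j)%N -> rho (near_core n r C j.+1) = rho (near_core n r C j).
  move=> kj; set G := near_core n r C j.
  have -> : near_core n r C j.+1 = G :|: near_core n r C j.+1.
    apply/esym/setUidPr/subsetP=> T; rewrite !inE => /andP[-> le] /=.
    exact: leqW.
  apply: (rank_setU_absorb R _ (complete_edges n r)); rewrite ?near_core_sub //.
  move=> T; rewrite inE => /andP[TE]; rewrite leq_eqVlt => /orP[/eqP cardT|lt].
    have [F [Fcopy TF FG]] :=
      exists_copy_near_core r H n C T S j HC uS TE (leq_trans Sk (kj : (k < j.+1)%N)) cardT.
    apply: (rank_setU1_closed R _ _ _ rhoP _ F) => //; rewrite ?near_core_sub //.
      by have [f []] := Fcopy.
    exact: satr.
  suff -> : T |: G = G by [].
  by apply/setUidPr; rewrite sub1set inE TE -ltnS.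
have all_steps i : rho (near_core n r C (k + i)) = rho (near_core n r C k).
  by elim: i => [|i IH]; rewrite ?addn0 // addnS step ?leq_addr.
(* Edges have only [r] vertices, so layer [k + r] already contains them all. *)
rewrite -(all_steps r); congr rho; apply/setP=> T; rewrite inE.
case: (boolP (T \in _)) => //=; rewrite inE => /eqP cardT.
by rewrite (leq_trans (subset_leq_card (subsetDl T C))) // cardT leq_addl.
Qed.

(** * Averaging over sets of outer vertices *)

Lemma rhosat_ge0 (R : realType) (r : nat) (H : uhypergraph r) (n : nat) :
  0 <= rhosat R H n.
Proof.
have [[rho [[rho_le _ _] _ <-]] _] := rhosat_max R H n.
by case/andP: (rho_le _ (subxx _)).
Qed.

(* The weights of the edges with fewer than [k] vertices outside the core are
   discarded; those of the other edges are averaged over the [m]-sets [U] of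
   outer vertices, as [U :|: C] spans a copy of the polymatroid on [m + #|H|]
   vertices. *)
Lemma rhosat_averaging (R : realType) (r : nat) (H : uhypergraph r) (k n m : nat)
    (S : {set H}) :
  in_unique_edge S -> #|S| = k.+1 -> (k <= m)%N -> (m + #|H| <= n)%N -> (0 < n)%N ->
  exists2 c : nat, (c * n <= 2 ^ #|H| * k * n ^ k)%N &
    (rhosat R H n - c%:R) * 'C(m, k)%:R <= rhosat R H (m + #|H|) * 'C(n - #|H|, k)%:R.
Proof.
move=> uS cardS km mn n0.
have [C _ cardC] : exists2 C : {set 'I_n}, C \subset [set: 'I_n] & #|C| = #|H|.
  by apply: exists_subset_card; rewrite cardsT card_ord (leq_trans _ mn) ?leq_addl.
have [[rho [rhoP satr rhoE]] _] := rhosat_max R H n.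
set G := near_core n r C k.
have rhoG : rho G = rhosat R H n.
  by rewrite -rhoE; apply: (rank_near_core R r H n k C S); rewrite ?cardC ?cardS.
have GE : G \subset complete_edges n r := near_core_sub n r C k.
have [w wG wle] := base_weights R _ _ rho rhoP G GE.
pose low := [set T : {set 'I_n} | (#|T :\: C| < k)%N].
exists #|low|.
  by have := card_sparse_outside _ C k; rewrite card_ord cardC; apply.
pose top := G :\: low.
have topE T : T \in top -> #|T :\: C| = k.
  by rewrite !inE -leqNgt => /and3P[kT _ Tk]; apply/eqP; rewrite eqn_leq Tk.
have [rho_le rho_mono _] := rhoP.
have low_le : \sum_(T in G :&: low) w T <= #|low|%:R.
  apply: le_trans (wle _ (subsetIl _ _)) _.
  have /andP[_] := rho_le _ (subset_trans (subsetIl G low) GE).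
  by move/le_trans; apply; rewrite ler_nat subset_leq_card ?subsetIr.
set N := (n - #|H|)%N.
have cardW : #|~: C| = N by rewrite cardsCs setCK card_ord cardC.
have block (U : {set 'I_n}) : (U \subset ~: C) && (#|U| == m) ->
    \sum_(T in top | T :\: C \subset U) w T <= rhosat R H (m + #|H|).
  case/andP=> UC /eqP cardU.
  have UCdisj : #|U :|: C| = (m + #|H|)%N.
    rewrite cardsU cardU cardC disjoint_setI0 ?cards0 ?subn0 //.
    by rewrite disjoints_subset.
  have [g gi gU] : exists2 g : 'I_(m + #|H|) -> 'I_n,
      {in [set: 'I_(m + #|H|)] &, injective g} &
      {in [set: 'I_(m + #|H|)], forall x, g x \in U :|: C}.
    apply: exists_in_injection; first exact: Ordinal n0.
    by rewrite cardsT card_ord UCdisj.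
  have {}gi : injective g by move=> x z; apply: gi; rewrite inE.
  have gim : g @: [set: 'I_(m + #|H|)] = U :|: C.
    apply/eqP; rewrite eqEcard card_imset // cardsT card_ord UCdisj leqnn andbT.
    by apply/subsetP=> _ /imsetP[x xT ->]; exact: gU.
  apply: le_trans (rank_image_le R r H n _ g rho gi rhoP satr).
  have -> : \sum_(T in top | T :\: C \subset U) w T =
      \sum_(T in [set T in top | T :\: C \subset U]) w T.
    by apply: eq_bigl => T; rewrite inE.
  apply: le_trans (wle _ _) _.
    by apply/subsetP=> T; rewrite !inE => /andP[/andP[_ ->]].
  apply: rho_mono; last first.
    apply/subsetP=> _ /imsetP[e eE ->]; rewrite inE card_imset //.
    by rewrite inE in eE.
  apply/subsetP=> T; rewrite inE => /andP[Ttop TU].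
  have TUC : T \subset g @: [set: 'I_(m + #|H|)] by rewrite gim setUC -subDset.
  have TE : T = g @: (g @^-1: T).
    apply/setP=> x; apply/idP/imsetP => [xT|[z]]; last by rewrite inE => zT ->.
    have /imsetP[z _ xz] := subsetP TUC _ xT.
    by exists z => //; rewrite inE -xz.
  apply/imsetP; exists (g @^-1: T) => //.
  rewrite inE -(card_imset _ gi) -TE.
  by move: Ttop; rewrite !inE => /and3P[].
have avg : (\sum_(T in top) w T) * 'C(N - k, m - k)%:R <=
    rhosat R H (m + #|H|) * 'C(N, m)%:R.
  have -> : (\sum_(T in top) w T) * 'C(N - k, m - k)%:R =
      \sum_(U : {set 'I_n} | (U \subset ~: C) && (#|U| == m))
        \sum_(T in top | T :\: C \subset U) w T.
    (* Double counting: the [k] outer vertices of each [T] in [top] lie in exactly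
       ['C(N - k, m - k)] of the sets [U]. *)
    rewrite (exchange_big_dep (mem top)) /=; last by move=> U T _ /andP[].
    rewrite mulr_suml; apply: eq_bigr => T Ttop.
    rewrite Ttop /= -cardW -(topE T Ttop) -card_supsets.
    - rewrite sumr_const mulr_natr; congr (_ *+ _).
      by apply: eq_card => U; rewrite inE.
    - by rewrite setDE subsetIr.
    - by rewrite (topE T Ttop).
  apply: le_trans (ler_sum _ block) _.
  rewrite sumr_const mulr_natr -cardW -cards_draws le_eqVlt; apply/orP; left.
  by apply/eqP; congr (_ *+ _); apply: eq_card => U; rewrite !inE.
have top_ge : rhosat R H n - #|low|%:R <= \sum_(T in top) w T.
  rewrite -rhoG -wG (big_setID low) /=.
  by rewrite lerBlDr addrC lerD2l.
have mN : (m <= N)%N by rewrite leq_subRL ?(leq_trans _ mn) ?leq_addl // addnC.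
have pos : 0 < 'C(N - k, m - k)%:R :> R by rewrite ltr0n bin_gt0 leq_sub2r.
(* By [bin_mul_bin], multiplying the goal by ['C(N - k, m - k)] turns its right side into that of
   [avg] times ['C(m, k)]. *)
rewrite -(ler_pM2r pos) -mulrA -[X in _ <= X]mulrA -natrM [X in _ * X%:R <= _]mulnC.
rewrite -natrM -bin_mul_bin ?km // !natrM !mulrA ler_wpM2r //.
by apply: le_trans avg; rewrite ler_wpM2r // ltW.
Qed.

(* Normalised bound and passage to the limit *)
From mathcomp Require Import all_classical all_reals all_analysis.

Import numFieldNormedType.Exports.

Local Open Scope classical_set_scope.

Lemma rhosat_density_le (R : realType) (r : nat) (H : uhypergraph r) (k n M : nat)
    (S : {set H}) :
  in_unique_edge S -> #|S| = k.+1 -> (#|H| + k < M <= n)%N ->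
  rhosat R H n / n%:R ^+ k <=
    (2 ^ #|H| * k)%:R / n%:R + rhosat R H M / (M - (#|H| + k))%:R ^+ k.
Proof.
move=> uS cardS /andP[qM Mn]; have n0 : (0 < n)%N by lia.
have km : (k <= M - #|H|)%N by lia.
have mn : (M - #|H| + #|H| <= n)%N by lia.
have [c c_le] := rhosat_averaging R r H k n _ S uS cardS km mn n0.
rewrite subnK; last by lia.
set m := (M - #|H|)%N => avg.
have -> : (M - (#|H| + k))%N = (m - k)%N by rewrite subnDA.
have pos_n : 0 < n%:R ^+ k :> R by rewrite exprn_gt0 // ltr0n.
have pos_m : 0 < (m - k)%:R ^+ k :> R by rewrite exprn_gt0 // ltr0n /m; lia.
have main : (rhosat R H n - c%:R) * (m - k)%:R ^+ k <= rhosat R H M * n%:R ^+ k.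
  (* Replacing [m ^_ k] by the smaller [(m - k) ^ k] requires a nonnegative factor, so the negative
     case is separate. *)
  have [lt0|ge0] := ltP (rhosat R H n - c%:R) 0.
    apply: (@le_trans _ _ 0); first by rewrite mulr_le0_ge0 ?ltW.
    by rewrite mulr_ge0 ?rhosat_ge0 ?ltW.
  apply: (@le_trans _ _ ((rhosat R H n - c%:R) * (m ^_ k)%:R)).
    by rewrite ler_wpM2l // -natrX ler_nat leq_expn_ffact.
  rewrite -bin_ffact natrM mulrA.
  apply: le_trans (ler_wpM2r (ler0n R k`!) avg) _.
  rewrite -mulrA -natrM bin_ffact ler_wpM2l ?rhosat_ge0 //.
  rewrite -natrX ler_nat (leq_trans (leq_ffact_expn _ _)) //.
  by case: (k) => // k'; rewrite leq_exp2r // leq_subr.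
have c_div : c%:R / n%:R ^+ k <= (2 ^ #|H| * k)%:R / n%:R :> R.
  rewrite ler_pdivrMr // mulrAC ler_pdivlMr ?ltr0n //.
  by rewrite -natrX -!natrM ler_nat.
rewrite -lerBlDl; apply: le_trans (_ : (rhosat R H n - c%:R) / n%:R ^+ k <= _).
  by rewrite mulrBl lerB.
by rewrite ler_pdivrMr // mulrAC ler_pdivlMr.
Qed.

Lemma bernoulli_ge (R : realFieldType) (x : R) (k : nat) :
  0 <= x <= 1 -> 1 - k%:R * x <= (1 - x) ^+ k.
Proof.
case/andP=> x0 x1; elim: k => [|k IH]; first by rewrite expr0 mul0r subr0.
have k0 : 0 <= k%:R :> R by [].
have := ler_wpM2l (_ : 0 <= 1 - x) IH; rewrite subr_ge0 => /(_ x1).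
by rewrite exprS -natr1; apply: le_trans; nra.
Qed.

Lemma cvg_ratio_of_inf_bound (R : realType) (f : nat -> R) (k q : nat) (D : R) :
  (forall n, 0 <= f n) ->
  (forall M n : nat, (q < M <= n)%N ->
    f n / n%:R ^+ k <= D / n%:R + f M / (M - q)%:R ^+ k) ->
  cvg ((fun n : nat => f n / n%:R ^+ k) @ \oo).
Proof.
move=> f0 f_le; pose v M := f M / (M - q)%:R ^+ k.
have v0 M : 0 <= v M by rewrite divr_ge0 // exprn_ge0.
pose V := [set v M | M in [set M | (q < M)%N]].
have V_lb : lbound V 0 by move=> _ [M _ <-].
have V_inf : has_inf V by split; [exists (v q.+1); exists q.+1 => /= | exists 0].
pose L := inf V.
have L0 : 0 <= L by apply: lb_le_inf => //; case: V_inf.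
have L_le M : (q < M)%N -> L <= v M.
  by move=> qM; apply: ge_inf; [case: V_inf | exists M].
apply/cvg_ex; exists L; apply/cvgrPdist_le => e e0.
(* Upper side: a fixed [M] comes within [e / 2] of the infimum, and [D / n] takes the other half for
   large [n]. *)
have [_ [M /= qM <-] vM] : exists2 x, V x & x < L + e / 2.
  by apply: inf_adherent => //; rewrite divr_gt0.
near=> n.
have Mn : (M <= n)%N by near: n; exact: nbhs_infty_ge.
have qn : (q < n)%N := leq_trans qM Mn.
have n0 : 0 < n%:R :> R by rewrite ltr0n; lia.
rewrite ler_norml; apply/andP; split.
  have De : D / n%:R <= e / 2.
    rewrite ler_pdivrMr // -ler_pdivrMl ?divr_gt0 //.
    by near: n; exact: nbhs_infty_ger.
  have := f_le M n; rewrite qM Mn => /(_ isT); rewrite -/(v M); lra.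
(* Lower side: [v n >= L] and Bernoulli give a ratio of at least [L * (1 - k * q / n)], whose loss
   is eventually below [e]. *)
have Le : L * (k%:R * (q%:R / n%:R)) <= e.
  rewrite !mulrA ler_pdivrMr // -ler_pdivrMl //.
  by near: n; exact: nbhs_infty_ger.
have ratio : f n / n%:R ^+ k = v n * (1 - q%:R / n%:R) ^+ k.
  have -> : 1 - q%:R / n%:R = (n - q)%:R / n%:R :> R.
    by rewrite (natrB _ (ltnW qn)) mulrBl divff ?gt_eqF.
  rewrite expr_div_n /v mulrA divfK // expf_neq0 // pnatr_eq0; lia.
have x01 : 0 <= (q%:R / n%:R : R) <= 1.
  by rewrite divr_ge0 //= ler_pdivrMr // mul1r ler_nat (ltnW qn).
have := ler_wpM2l L0 (bernoulli_ge _ _ k x01).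
have := ler_wpM2r (_ : 0 <= (1 - q%:R / n%:R) ^+ k) (L_le n qn).
rewrite exprn_ge0 ?subr_ge0; last by case/andP: x01.
rewrite -ratio => /(_ isT); lra.
Unshelve. all: by end_near.
Qed.

Theorem theorem9p4 (R : realType) (r s : nat) (H : uhypergraph r)
    (r_ge1 : (1 <= r)%N) (s_ge1 : (1 <= s)%N)
    (H_nonempty : edges H != finset.set0) (sH : sparseness H = s) :
  cvg ((fun n : nat => rhosat R H n / n%:R ^+ (s - 1)) @ \oo).
Proof.
have [[S uS cardS] _] := sparsenessP H_nonempty.
have {}cardS : #|S| = (s - 1).+1 by rewrite cardS sH; lia.
apply: (cvg_ratio_of_inf_bound _ _ _ (#|H| + (s - 1)) (2 ^ #|H| * (s - 1))%:R).
  exact: rhosat_ge0.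
by move=> M n; exact: (rhosat_density_le _ _ _ _ _ _ S).
Qed.
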